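(* Let $\chi>0$, $\alpha\ge 0$ and $\mu\ge 1$ be such that either ($\alpha<\chi$ and $\mu<\chi/\alpha$) or $\alpha<\chi/2$ (where $\chi/\alpha=\infty$ if $\alpha=0$). Then there exists an instance in which $G$ is a tree with root eccentricity $\chi$ such that no incremental solution $\pi$ satisfies $\mu\, p(\pi(B+\alpha))\ge p(\textsc{Opt}(B))$ for all $B\in\mathbb{R}_{\ge 0}$. In particular, no algorithm is $(\alpha,\mu)$-competitive for such $\alpha,\mu$, even on trees.
   Context: An instance consists of a finite undirected graph $G=(V,E)$, edge costs $c(e)>0$, vertex prizes $p(v)\ge 0$, and a root $r\in V$. For a subgraph $G'=(V',E')$ write $p(G')=\sum_{v\in V'}p(v)$ and $c(G')=\sum_{e\in E'}c(e)$. A rooted subtree is a subtree of $G$ containing $r$. For $B\ge 0$, $\textsc{Opt}(B)$ is a rooted subtree maximizing $p(T)$ subject to $c(T)\le B$. Let $V^*=\{v:p(v)>0\}$. An incremental solution is a sequence $\pi=(e_1,\dots,e_l)$ of distinct edges such that for every $j\le l$ the edges $e_1,\dots,e_j$ together with $r$ form a rooted subtree, and the tree formed by all of them spans $V^*$. For $B\ge 0$, $\pi(B)$ is the rooted subtree formed by $r$ and the edges $e_i$ with $\sum_{j\le i}c(e_j)\le B$. An algorithm (producing an incremental solution $\textsc{Alg}$ for every instance) is $(\alpha,\mu)$-competitive if for every instance its output satisfies $\mu\,p(\textsc{Alg}(B+\alpha))\ge p(\textsc{Opt}(B))$ for all $B\ge0$. The root eccentricity is $\chi=\max_{v\in V}\ell(v)$,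 where $\ell(v)$ is the minimum cost of an $r$-$v$ path. *)

(* Defs.v *)
From HB Require Import structures.
From mathcomp Require Import all_boot all_order all_algebra.
From mathcomp Require Import boolp reals.

Set Implicit Arguments.
Unset Strict Implicit.
Unset Printing Implicit Defensive.

Import Order.TTheory GRing.Theory Num.Theory.

Local Open Scope ring_scope.

(* An edge is the two-element set of its endpoints; values of [cost] outside
   [edges] are irrelevant.  Connectedness is not part of the structure. *)
Record instance (R : realType) := Instance {
  vertex : finType;
  edges : {set {set vertex}};
  edges_card : forall e, e \in edges -> #|e| = 2%N;
  cost : {set vertex} -> R;
  cost_gt0 : forall e, e \in edges -> 0 < cost e;
  prize : vertex -> R;
  prize_ge0 : forall v, 0 <= prize v;
  root_vertex : vertex }.

Section Graphs.
Variable V : finType.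

(* A pair (vertices, edges); see [is_graph] for the incidence condition. *)
Definition graph : Type := ({set V} * {set {set V}})%type.

Definition is_graph (H : graph) : Prop :=
  forall e, e \in H.2 -> #|e| = 2%N /\ e \subset H.1.

(* Irreflexive when all members of F have two elements. *)
Definition adjacent (F : {set {set V}}) : rel V :=
  fun x y => [set x; y] \in F.

Definition connected (H : graph) : Prop :=
  {in H.1 &, forall x y, connect (adjacent H.2) x y}.

Definition acyclic (H : graph) : Prop :=
  forall c : seq V, uniq c -> (2 < size c)%N -> ~~ cycle (adjacent H.2) c.

Definition is_tree (H : graph) : Prop :=
  [/\ is_graph H, H.1 != set0, connected H & acyclic H].

End Graphs.

Section Instances.
Variables (R : realType) (I : instance R).
Local Notation V := (vertex I).

Definition whole_graph : graph V := ([set: V]%SET, edges I).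

Definition tree_instance : Prop := is_tree whole_graph.

Definition connected_instance : Prop := connected whole_graph.

Definition total_prize (H : graph V) : R := \sum_(v in H.1) prize v.

Definition total_cost (H : graph V) : R := \sum_(e in H.2) cost e.

Definition rooted_subtree (H : graph V) : Prop :=
  [/\ H.2 \subset edges I, is_tree H & root_vertex I \in H.1].

Definition root_graph : graph V := ([set root_vertex I]%SET, set0).

(* For B >= 0 the root alone is feasible, so this is a maximizer; for B < 0 the
   value is meaningless. *)
Definition Opt (B : R) : graph V :=
  [arg max_(H > root_graph | `[< rooted_subtree H /\ total_cost H <= B >])
     total_prize H]%O.

Definition formed_by (F : {set {set V}}) : graph V :=
  (root_vertex I |: cover F, F)%SET.

Definition incremental_solution (s : seq {set V}) : Prop :=
  [/\ uniq s,
      (forall j, (j <= size s)%N ->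
         rooted_subtree (formed_by [set:: take j s]))
    & (forall v, 0 < prize v -> v \in (formed_by [set:: s]).1)].

Definition upto (s : seq {set V}) (B : R) : graph V :=
  formed_by [set nth set0 s i
            | i : 'I_(size s) & \sum_(e <- take i.+1 s) cost e <= B]%SET.

Definition competitive_solution (alpha mu : R) (s : seq {set V}) : Prop :=
  forall B, 0 <= B ->
    total_prize (Opt B) <= mu * total_prize (upto s (B + alpha)).

Definition root_path (v : V) (p : seq V) : Prop :=
  [/\ path (adjacent (edges I)) (root_vertex I) p, uniq (root_vertex I :: p)
    & last (root_vertex I) p = v].

Definition path_cost (p : seq V) : R :=
  \sum_(e <- pairmap (fun x y => [set x; y]%SET) (root_vertex I) p) cost e.

Definition is_root_dist (v : V) (d : R) : Prop :=
  (exists2 p, root_path v p & path_cost p = d) /\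
  (forall p, root_path v p -> d <= path_cost p).

(* No value is a root eccentricity when some vertex is unreachable. *)
Definition is_root_eccentricity (chi : R) : Prop :=
  exists l : V -> R,
    [/\ forall v, is_root_dist v (l v), exists v, l v = chi
      & forall v, l v <= chi].

End Instances.

Definition algorithm (R : realType) : Type :=
  forall I : instance R, seq {set vertex I}.

(* The guarantee is relative to a class C of instances: on a disconnected
   instance there may be no incremental solution at all, so requiring a solution
   on literally every instance would exclude every algorithm. *)
Definition competitive_on (R : realType) (C : instance R -> Prop)
    (alpha mu : R) (A : algorithm R) : Prop :=
  forall I, C I ->
    incremental_solution (A I) /\ competitive_solution alpha mu (A I).

(* Main.v *)
(* Take a star whose leaves all hang off the root: one leaf at distance [chi]
   carries a huge prize, and [n] cheap leaves at distance [eps] carry prize 1.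
   Let [k] be the number of cheap leaves collected before the huge one.  If
   [k eps > alpha], the huge leaf is still missing at budget [chi + alpha],
   although Opt(chi) contains it.  Otherwise, take [B + alpha] just below
   [k eps + chi], when the huge leaf is about to be paid for: the solution has
   only collected prize [k], whereas Opt(B) gets about [k + (chi - alpha) / eps]
   from cheap leaves.  This exceeds [mu k] when [mu alpha < chi] and
   [n = chi / eps] is large; when [alpha < chi / 2], the choice [n = 1],
   [eps = chi / 2] works for every [mu]. *)
Require Import Defs.
From mathcomp Require Import all_boot all_order all_algebra.
From mathcomp Require Import reals.
From mathcomp Require Import boolp lra.
Import Order.TTheory GRing.Theory Num.Theory.
Local Open Scope ring_scope.

Set Implicit Arguments.
Unset Strict Implicit.
Unset Printing Implicit Defensive.

(** * Collected prize and [Opt] in an arbitrary instance *)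

Section GeneralInstance.
Variables (R : realType) (I : instance R).
Implicit Types (F G : {set {set vertex I}}) (s : seq {set vertex I}).

Lemma total_prize_formed_by_le F G :
  F \subset G -> total_prize (formed_by F) <= total_prize (formed_by G).
Proof.
move=> sFG; rewrite /total_prize big_mkcond [leRHS]big_mkcond /=.
apply: ler_sum => v _.
have sub : v \in root_vertex I |: cover F -> v \in root_vertex I |: cover G.
  rewrite !in_setU1 => /orP[-> //|/bigcupP[e eF ve]].
  by apply/orP; right; apply/bigcupP; exists e => //; apply: (subsetP sFG).
case: ifP => [/sub -> //|_]; case: ifP => // _; exact: prize_ge0.
Qed.

(** Edge costs are positive, so prefix costs increase: once the first [k.+1] edges exceed [B], so
    does every longer prefix. *)
Lemma upto_sub_take s B k :
    {subset s <= edges I} -> B < \sum_(e <- take k.+1 s) cost e ->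
  (upto s B).2 \subset [set:: take k s].
Proof.
move=> sE ltB; apply/subsetP => e /imsetP[i]; rewrite !inE => lei ->.
have [ltik|leki] := ltnP i k.
  by rewrite -(nth_take _ ltik) mem_nth // size_take_min leq_min ltik ltn_ord.
have: \sum_(e <- take k.+1 s) cost e <= \sum_(e <- take i.+1 s) cost e.
  rewrite -[X in _ <= \sum_(e <- X) _](cat_take_drop k.+1) take_takel //.
  rewrite big_cat lerDl /= big_seq sumr_ge0 // => e' /mem_drop/mem_take/sE.
  by move/(@cost_gt0 R I)/ltW.
by move/le_trans/(_ lei); rewrite leNgt ltB.
Qed.

Lemma incremental_solution_edges s :
  incremental_solution s -> {subset s <= edges I}.
Proof.
case=> _ /(_ _ (leqnn _)) + _; rewrite take_size => -[/subsetP sE _ _] e es.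
by apply: sE; rewrite inE.
Qed.

(** The first two hypotheses make the default of the arg max feasible, so that [Opt] is a genuine
    maximizer. *)
Lemma rooted_subtree_le_Opt (H : graph (vertex I)) (B : R) :
    rooted_subtree (root_graph I) -> 0 <= B ->
    rooted_subtree H -> total_cost H <= B ->
  total_prize H <= total_prize (Opt I B).
Proof.
move=> rootT B_ge0 HT costH; rewrite /Opt; case: arg_maxP => [|K _ maxK].
  by apply/asboolP; split; rewrite // /total_cost big_set0.
by apply: maxK; apply/asboolP.
Qed.

End GeneralInstance.

(** * Stars with arbitrary leaf costs and prizes *)

Section Star.
Variables (R : realType) (L : finType) (c p : L -> R).
Hypotheses (c_gt0 : forall l, 0 < c l) (p_ge0 : forall l, 0 <= p l).

Definition spoke (l : L) : {set option L} := [set None; Some l].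

(** The root is [None], of weight 0. This one extension gives prizes, root distances and, summed
    over endpoints, edge costs. *)
Definition star_weight (f : L -> R) (v : option L) : R := oapp f 0 v.

Lemma spoke_inj : injective spoke.
Proof.
by move=> l l' /setP/(_ (Some l)); rewrite !inE eqxx /= => /esym/eqP[].
Qed.

Lemma sum_spoke l : \sum_(v in spoke l) star_weight c v = c l.
Proof. by rewrite big_setU1 ?inE //= big_set1 add0r. Qed.

Fact spoke_card e : e \in [set spoke l | l : L] -> #|e| = 2%N.
Proof. by case/imsetP=> l _ ->; rewrite cards2. Qed.

Fact spoke_cost_gt0 e :
  e \in [set spoke l | l : L] -> 0 < \sum_(v in e) star_weight c v.
Proof. by case/imsetP=> l _ ->; rewrite sum_spoke. Qed.

Fact star_prize_ge0 v : 0 <= star_weight p v.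
Proof. by case: v => /=. Qed.

Definition star : instance R :=
  @Instance R (option L) [set spoke l | l : L] spoke_card
    (fun e => \sum_(v in e) star_weight c v) spoke_cost_gt0
    (star_weight p) star_prize_ge0 None.

Definition substar (A : {set L}) : graph (option L) :=
  @formed_by R star (spoke @: A).

Lemma mem_substar A l : (Some l \in (substar A).1) = (l \in A).
Proof.
rewrite !inE /=; apply/bigcupP/idP => [[_ /imsetP[l' Al' ->]]|Al].
  by rewrite !inE /= => /eqP[->].
by exists (spoke l); rewrite ?imset_f // !inE eqxx.
Qed.

Lemma adjacent_spoke (A : {pred L}) x y :
  adjacent (spoke @: A) x y -> (x == None) || (y == None).
Proof.
case/imsetP=> l _ /setP/(_ None); rewrite !inE /= => /orP[] /eqP <-;
  by rewrite ?orbT.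
Qed.

Lemma substar_tree A : is_tree (substar A).
Proof.
have symA : connect_sym (adjacent (spoke @: A)).
  by apply: sym_connect_sym => x y; rewrite /adjacent setUC.
split.
- move=> e eA; split; first by case/imsetP: eA => l _ ->; rewrite cards2.
  by apply/subsetU/orP; right; apply: bigcup_sup.
- by apply/set0Pn; exists None; rewrite !inE.
- have cN x : x \in (substar A).1 -> connect (adjacent (spoke @: A)) None x.
    case: x => [l|] //; rewrite mem_substar => Al.
    by apply/connect1/imset_f.
  move=> x y /cN cx /cN cy; apply: connect_trans cy; by rewrite symA.
(* Of two adjacent vertices one is the root, so a cycle visits it twice. *)
- case=> [|x [|y [|z c']]] // + _; apply: contraTN => /=.
  rewrite rcons_path => /and4P[/adjacent_spoke xy /adjacent_spoke yz _].
  move=> /adjacent_spoke lx.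
  apply/negP => /andP[]; rewrite !inE !negb_or => /and3P[nxy nxz _].
  case/andP=> /andP[nyz yc] _.
  (* If [y] is the root, the contradiction comes from the closing edge, between [last z c'] and [x],
     which avoids [y]. *)
  have nyl : y != last z c'.
    by have := mem_last z c'; apply: contraTneq => <-; rewrite inE negb_or nyz.
  case: x y z xy yz lx nxy nxz nyz nyl {yc} => [x|] [y|] [z|] //=.
  by case: (last _ _).
Qed.

Lemma substar_rooted A : @rooted_subtree R star (substar A).
Proof.
split; last by rewrite !inE.
  by apply/subsetP => _ /imsetP[l _ ->]; apply: imset_f.
exact: substar_tree.
Qed.

Lemma substar0 : substar set0 = root_graph star.
Proof. by rewrite /substar /formed_by imset0 /cover big_set0 setU0. Qed.

Lemma substarT : substar setT = whole_graph star.
Proof.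
congr pair; last by apply/setP => e; apply/imsetP/imsetP => -[l _ ->]; exists l.
by apply/setP => -[l|]; rewrite ?mem_substar !inE.
Qed.

Lemma star_tree : tree_instance star.
Proof. by rewrite /tree_instance -substarT; apply: substar_tree. Qed.

Lemma substar_prize A : @total_prize R star (substar A) = \sum_(l in A) p l.
Proof.
have defV : (substar A).1 = None |: Some @: A.
  apply/setP => -[l|]; last by rewrite !inE.
  by rewrite mem_substar in_setU1 mem_imset //; apply: Some_inj.
rewrite /total_prize defV big_setU1; last by apply/imsetP => -[].
by rewrite big_imset /= ?add0r // => ? ? _ _ [].
Qed.

Lemma substar_cost A : @total_cost R star (substar A) = \sum_(l in A) c l.
Proof.
rewrite /total_cost big_imset /=; last by move=> ? ? _ _; apply: spoke_inj.
by apply: eq_bigr => l _; rewrite sum_spoke.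
Qed.

Lemma star_Opt_ge (A : {set L}) (B : R) :
  \sum_(l in A) c l <= B -> \sum_(l in A) p l <= total_prize (Opt star B).
Proof.
move=> leB; rewrite -substar_prize; apply: rooted_subtree_le_Opt.
- by rewrite -substar0; apply: substar_rooted.
- by apply: le_trans leB; apply: sumr_ge0 => l _; apply: ltW.
- exact: substar_rooted.
- by rewrite substar_cost.
Qed.

(** From a leaf the only step leads back to the root, which a simple path cannot revisit. *)
Lemma star_root_path v q :
  @root_path R star v q -> q = if v is Some l then [:: Some l] else [::].
Proof.
case=> + + <-; case: q => [|[a|] [|b q]] //=.
by case/and3P=> _ /adjacent_spoke /= /eqP ->; rewrite !inE.
Qed.

Lemma star_root_dist v : @is_root_dist R star v (star_weight c v).
Proof.
have costE q : @root_path R star v q -> @path_cost R star q = star_weight c v.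
  move=> /star_root_path ->; rewrite /path_cost.
  by case: v => [l|] /=; rewrite ?big_nil // big_seq1 sum_spoke.
split; last by move=> q /costE ->.
pose q := if v is Some l then [:: Some l] else [::].
have qP : @root_path R star v q.
  rewrite /q; case: v {costE q} => [l|]; split; rewrite //= andbT.
  exact: imset_f.
by exists q; last exact: costE.
Qed.

Lemma star_eccentricity b :
  (forall l, c l <= c b) -> @is_root_eccentricity R star (c b).
Proof.
move=> maxb; exists (star_weight c); split; first exact: star_root_dist.
  by exists (Some b).
by case=> [l|] //=; apply: ltW.
Qed.

(** From here on a solution is treated as an order of leaves: every edge is a spoke, and [spoke] is
    injective. *)
Lemma star_incremental s : @incremental_solution R star s ->
  exists t, [/\ s = map spoke t, uniq t & forall l, 0 < p l -> l \in t].
Proof.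
move=> incs; have sE := @incremental_solution_edges R star s incs.
have [t def_s] : exists t, s = map spoke t.
  elim: {incs} s sE => [|e s IHs] sE; first by exists [::].
  have /imsetP[l _ ->] := sE e (mem_head _ _).
  have [|t ->] := IHs; last by exists (l :: t).
  by move=> e' se'; apply: sE; rewrite inE se' orbT.
case: incs => + _ cover_s; rewrite def_s (map_inj_uniq spoke_inj) => Ut.
exists t; split=> // l /(cover_s (Some l)); rewrite def_s !inE /=.
case/bigcupP=> e; rewrite inE => /mapP[l' tl' ->].
by rewrite !inE /= => /eqP[->].
Qed.

Lemma star_upto_le t B k : uniq t -> B < \sum_(l <- take k.+1 t) c l ->
  total_prize (@upto R star (map spoke t) B) <= \sum_(l <- take k t) p l.
Proof.
move=> Ut ltB; have /total_prize_formed_by_le : 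
    (@upto R star (map spoke t) B).2 \subset [set:: take k (map spoke t)].
  apply: upto_sub_take => [e /mapP[l _ ->]|]; first exact: imset_f.
  by rewrite -map_take big_map; under eq_bigr do rewrite /= sum_spoke.
move=> /le_trans; apply; rewrite -map_take.
have -> : [set:: map spoke (take k t)] = spoke @: [set:: take k t].
  apply/setP => e; rewrite inE; apply/mapP/imsetP => -[l tl ->];
    by exists l; rewrite // inE in tl *.
rewrite (substar_prize [set:: take k t]) [leRHS]big_uniq ?take_uniq //=.
by under eq_bigl do rewrite inE.
Qed.

End Star.

(** * The star with one expensive bait and [n] cheap leaves *)

Section Bait.
Variables (R : realType) (n : nat) (chi eps P : R).
Hypotheses (eps_gt0 : 0 < eps) (eps_le : eps <= chi) (P_gt0 : 0 < P).

(** The leaf [None] is the bait; as a vertex it is [Some None], distinct from the root [None]. *)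
Definition bait_cost (l : option 'I_n) : R := if l is Some _ then eps else chi.
Definition bait_prize (l : option 'I_n) : R := if l is Some _ then 1 else P.

Fact bait_cost_gt0 l : 0 < bait_cost l.
Proof. by case: l => //=; apply: lt_le_trans eps_le. Qed.

Fact bait_prize_gt0 l : 0 < bait_prize l. Proof. by case: l => /=. Qed.

Fact bait_prize_ge0 l : 0 <= bait_prize l.
Proof. exact/ltW/bait_prize_gt0. Qed.

Definition bait : instance R := star bait_cost_gt0 bait_prize_ge0.

Lemma bait_eccentricity : is_root_eccentricity bait chi.
Proof. by apply: (@star_eccentricity _ _ _ _ _ _ None); case. Qed.

(** The third hypothesis ranges over all [k] because the solution chooses how many cheap leaves
    precede the bait. *)
Lemma bait_not_competitive (alpha mu : R) : 0 <= mu -> mu * n%:R < P ->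
    (forall k, alpha < k%:R * eps \/ exists2 m, (m <= n)%N &
       m%:R * eps + alpha < k%:R * eps + chi /\ mu * k%:R < m%:R) ->
  ~ exists s, incremental_solution s /\ @competitive_solution R bait alpha mu s.
Proof.
move=> mu_ge0 ltP wait [s [/star_incremental[t [-> Ut memt]] comp]].
have tN : None \in t by apply/memt/bait_prize_gt0.
pose k := index None t; have ltk : (k < size t)%N by rewrite index_mem.
have szk : size (take k t) = k by rewrite size_takel // ltnW.
have Nk : None \notin take k t by rewrite in_take // ltnn.
have sum_k (f : option 'I_n -> R) x : (forall i, f (Some i) = x) ->
    \sum_(l <- take k t) f l = k%:R * x.
  move=> fx; rewrite big_seq (eq_bigr (fun=> x)) => [|[i|] // /(negP Nk)//].
  by rewrite -big_seq big_const_seq count_predT szk iter_addr_0 mulr_natl.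
(* The prefix ending with the bait costs [k%:R * eps + chi]; below that budget only the [k] cheap
   leaves before it can be collected. *)
have ub B : B < k%:R * eps + chi ->
    total_prize (@upto R bait (map (@spoke _) t) B) <= k%:R.
  move=> ltB; rewrite -[leRHS]mulr1 -(@sum_k bait_prize 1) //.
  apply: star_upto_le => //; rewrite (take_nth None) // -cats1 big_cat big_seq1.
  by rewrite (@sum_k bait_cost eps) // nth_index.
have lekn : (k <= n)%N.
  have := leq_trans ltk (uniq_leq_size Ut (fun l _ => mem_enum _ l)).
  by rewrite -cardT card_option card_ord.
have chi_gt0 : 0 < chi by apply: lt_le_trans eps_le.
case: (wait k) => [lt_alpha | [m lemn [ltm ltmu]]].
(* Budget [chi] buys the bait alone, while [chi + alpha] leaves the solution with prize at most
   [k <= n]. *)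
- have := comp chi (ltW chi_gt0); apply/negP; rewrite -ltNge.
  have: P <= total_prize (Opt bait chi).
    rewrite -[P](big_set1 +%R None bait_prize).
    by apply: star_Opt_ge; rewrite big_set1.
  apply: lt_le_trans; apply: le_lt_trans ltP; apply: ler_wpM2l => //.
  by apply: le_trans (ub _ _) _; rewrite ?ler_nat // addrC ltrD2r.
(* This budget buys exactly [m] cheap leaves. *)
- have := comp (m%:R * eps); rewrite mulr_ge0 ?(ltW eps_gt0) // => /(_ isT).
  apply/negP; rewrite -ltNge.
  pose A := [set Some i | i : 'I_n & (i < m)%N].
  have sumA (f : option 'I_n -> R) x : (forall i, f (Some i) = x) ->
      \sum_(l in A) f l = m%:R * x.
    move=> fx; rewrite big_imset /=; last by move=> ? ? _ _ [].
    under eq_bigl do rewrite inE; under eq_bigr do rewrite fx.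
    rewrite -(big_ord_widen n (fun=> x)) //.
    by rewrite sumr_const card_ord mulr_natl.
  have: m%:R <= total_prize (Opt bait (m%:R * eps)).
    rewrite -[leLHS]mulr1 -(@sumA bait_prize 1) //.
    by apply: star_Opt_ge; rewrite (@sumA bait_cost eps).
  apply: lt_le_trans; apply: le_lt_trans ltmu.
  exact/ler_wpM2l/ub.
Qed.

End Bait.

(** * Choice of the number and cost of the cheap leaves *)

Lemma bait_parameters (R : realType) (chi alpha mu : R) :
    0 < chi -> 0 <= alpha -> 1 <= mu ->
    (alpha < chi /\ (alpha = 0 \/ mu < chi / alpha)) \/ alpha < chi / 2 ->
  exists n (eps : R), [/\ 0 < eps, eps <= chi
    & forall k, alpha < k%:R * eps \/ exists2 m, (m <= n)%N &
        m%:R * eps + alpha < k%:R * eps + chi /\ mu * k%:R < m%:R].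
Proof.
move=> chi_gt0 alpha_ge0 mu_ge1 bound.
have [half_alpha | alpha_half] := ltP alpha (chi / 2).
  (* For [k = 0] the solution holds no prize, so [m = 1] beats every [mu]; for larger [k] the cheap
     cost is at least [chi / 2], above [alpha]. *)
  exists 1%N, (chi / 2); split; [lra | lra | case=> [|k]].
    by right; exists 1%N; rewrite // mulr0; split; lra.
  left; apply: lt_le_trans half_alpha _.
  by rewrite ler_peMl ?ler1n //; lra.
have {bound} [lt_alpha mu_alpha] : alpha < chi /\ mu * alpha < chi.
  case: bound => [[lt_alpha [alpha0|]]|]; [lra | | lra].
  by rewrite ltr_pdivlMr; [split | lra].
(* Taking [n > x] makes [eps = chi / n] smaller than the slack [chi - mu * alpha], which will absorb
   a rounding error of one leaf. *)
pose x := chi / (chi - mu * alpha).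
have x_ge0 : 0 <= x by apply: divr_ge0; lra.
pose n := Num.bound x; have ltn : x < n%:R by apply: archi_boundP.
have n_gt0 : 0 < n%:R :> R by apply: le_lt_trans ltn.
have n_ge1 : 1 <= n%:R :> R by rewrite ler1n -(ltr0n R).
pose eps := chi / n%:R.
have eps_gt0 : 0 < eps by apply: divr_gt0.
have n_eps : n%:R * eps = chi by rewrite mulrC divfK // gt_eqF.
have eps_small : eps < chi - mu * alpha.
  by rewrite ltr_pdivrMr // mulrC -ltr_pdivrMr //; lra.
exists n, eps; split=> // [|k].
  by rewrite ler_pdivrMr // ler_peMr // ltW.
have [|k_eps] := ltP alpha (k%:R * eps); [by left | right].
(* The least such [D] is positive; its predecessor [d] is the largest number with
   [d%:R * eps < chi - alpha], and [m = k + d]. *)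
have exD : exists D, chi - alpha <= D%:R * eps by exists n; lra.
case: (ex_minnP exD) => -[|d] leD minD; first by lra.
have ltd : d%:R * eps < chi - alpha.
  by rewrite ltNge; apply/negP => /minD; rewrite ltnn.
rewrite -natr1 in leD.
exists (k + d)%N.
  by rewrite -(ler_nat R) -(ler_pM2r eps_gt0) natrD; lra.
rewrite natrD; split; first lra.
(* Times [eps], the claim is that [(mu - 1) * k * eps < d * eps]. The left side is at most
   [(mu - 1) * alpha]; the right is at least [chi - alpha - eps], which is larger by [eps_small]. *)
rewrite -(ltr_pM2r eps_gt0).
have : (mu - 1) * (k%:R * eps) <= (mu - 1) * alpha by apply: ler_wpM2l; lra.
lra.
Qed.

Theorem theorem2 (R : realType) (chi alpha mu : R)
  (chi_gt0 : 0 < chi) (alpha_ge0 : 0 <= alpha) (mu_ge1 : 1 <= mu)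
  (Hbound : (alpha < chi /\ (alpha = 0 \/ mu < chi / alpha)) \/ alpha < chi / 2) :
  (exists I : instance R,
     [/\ tree_instance I, is_root_eccentricity I chi
       & ~ exists s, incremental_solution s /\
                     @competitive_solution R I alpha mu s])
  /\ (~ exists A : algorithm R, competitive_on (@connected_instance R) alpha mu A)
  /\ (~ exists A : algorithm R, competitive_on (@tree_instance R) alpha mu A).
Proof.
have [n [eps [eps_gt0 eps_le wait]]] :=
  bait_parameters chi_gt0 alpha_ge0 mu_ge1 Hbound.
have mu_ge0 : 0 <= mu by lra.
(* This bait prize exceeds [mu] times the prize of all cheap leaves together. *)
have P_gt0 : 0 < mu * n%:R + 1 by rewrite ltr_wpDl ?mulr_ge0.
pose I := bait n eps_gt0 eps_le P_gt0.
have treeI : tree_instance I by apply: star_tree.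
have hardI : ~ exists s, incremental_solution s /\
    @competitive_solution R I alpha mu s.
  by apply: bait_not_competitive wait; rewrite ?ltrDl.
split; first by exists I; split=> //; apply: bait_eccentricity.
(* The same instance lies in both classes and refutes both kinds of algorithm. *)
have connI : connected_instance I by case: treeI.
by split=> -[A compA]; apply: hardI; exists (A I); apply: compA.
Qed.
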